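(* Let $n\ge 2$ be a fixed integer. Suppose that $X_1,X_2,\ldots,X_n$ are independent copies of a non-negative random variable $X$ with density $f$. Assume that $X$ satisfies Cramér's condition: there is a number $t_0>0$ such that $\mathsf{E}[e^{-tX}]<\infty$ for all $t\in(-t_0,t_0)$. If the random variable $$X_1+\frac12X_2+\cdots+\frac1nX_n$$ has density $$\sum_{j=1}^n\binom{n}{j}(-1)^{j-1}\,j\,f(jx),\qquad x\ge 0,$$ then $X\sim\mathrm{Exp}(\lambda)$ for some $\lambda>0$.
   Context: $X\sim\mathrm{Exp}(\lambda)$ (with $\lambda>0$) means that $X$ has density $\lambda e^{-\lambda x}$ for $x\ge 0$ (and $0$ for $x<0$). ''Independent copies of $X$'' means independent random variables each with the same distribution as $X$. Densities are with respect to Lebesgue measure; as the variables are non-negative, their densities vanish on $x<0$ and are specified on $x\ge 0$. *)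

(* Defs.v *)
From HB Require Import structures.
From mathcomp Require Import all_boot all_order all_algebra.
From mathcomp Require Import all_classical all_reals all_analysis.

Set Implicit Arguments.
Unset Strict Implicit.
Unset Printing Implicit Defensive.

Import Order.TTheory GRing.Theory Num.Theory.
Import numFieldNormedType.Exports.

Local Open Scope classical_set_scope.
Local Open Scope ring_scope.

(* [g] is a version of the Radon-Nikodym derivative of the law of [Y] with
   respect to Lebesgue measure. No pointwise condition is put on [g]: that
   [0 <= g] almost everywhere follows by taking [A := [set x | g x < 0]]. *)
Definition has_density (d : measure_display) (T : measurableType d)
    (R : realType) (P : probability T R) (Y : T -> R) (g : R -> R) : Prop :=
  measurable_fun setT g /\
  forall A : set R, measurable A ->
    pushforward P Y A = (\int[lebesgue_measure]_(x in A) (g x)%:E)%E.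

Definition mutually_independent (d : measure_display) (T : measurableType d)
    (R : realType) (P : probability T R) (I : finType)
    (X : I -> {RV P >-> R}) : Prop :=
  forall (J : {set I}) (A : I -> set R), (forall i, measurable (A i)) ->
    P (\bigcap_(i in [set` J]) (X i @^-1` A i)) =
    (\prod_(i in J) P (X i @^-1` A i))%E.

(* [X] is allowed to live on another probability space than its copies. *)
Definition independent_copies (d d0 : measure_display) (T : measurableType d)
    (T0 : measurableType d0) (R : realType) (P : probability T R)
    (P0 : probability T0 R) (I : finType)
    (Xs : I -> {RV P >-> R}) (X : {RV P0 >-> R}) : Prop :=
  mutually_independent Xs /\
  forall (i : I) (A : set R), measurable A ->
    distribution P (Xs i) A = distribution P0 X A.

Definition cramer_condition (d : measure_display) (T : measurableType d)
    (R : realType) (P : probability T R) (X : {RV P >-> R}) : Prop :=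
  exists2 t0 : R, 0 < t0 &
    forall t : R, t \in `]- t0, t0[ ->
      ('E_P[fun w => expR (- t * X w)%R] < +oo)%E.

(* Main.v *)
(* Let phi t = E[e^(-tX)] for t >= 0 and c_j = (-1)^(j-1) C(n, j). Taking Laplace
   transforms, the hypothesis becomes
     prod_j phi(t / j) = sum_j c_j phi(t / j),
   and by partial fractions psi t = 1 / (1 + t E[X]), the transform of an
   exponential law with the same mean, is another solution. The difference
   D = phi - psi satisfies sum_j (c_j - w_j(t)) D(t / j) = 0 for some weights w_j
   in [0, 1] with w_j(t) = 1 + O(t). Cramer's condition gives D a Taylor
   expansion at 0+ of every order. A first nonzero coefficient, of order k >= 2,
   would satisfy sum_j c_j / j^k = sum_j 1 / j^k, whereas the left side is
   strictly larger. Hence D = O(t^K) for all K, and for K large the equation,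
   solved for D(t) (c_1 - w_1 >= n - 1 >= 1), is a contraction in the norm
   sup |D(t)| / t^K: so D = 0 on [0, +oo[. Equality of the laws follows by
   uniqueness of the Laplace transform. *)

Require Import Defs.
From HB Require Import structures.
From mathcomp Require Import all_boot all_order all_algebra.
From mathcomp Require Import all_classical all_reals all_analysis.
From mathcomp Require Import measurable_realfun ring lra.

Set Implicit Arguments.
Unset Strict Implicit.
Unset Printing Implicit Defensive.

Import Order.TTheory GRing.Theory Num.Theory.
Import numFieldNormedType.Exports.

Local Open Scope classical_set_scope.
Local Open Scope ring_scope.

(** * Alternating binomial sums and the functional equation *)

(** The index is shifted by one: [altbin R n i] is the coefficient c_j for j = i+1. *)
Definition altbin (R : realFieldType) (n i : nat) : R :=
  'C(n, i.+1)%:R * (-1) ^+ i.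

(** Pascal's rule, with the term C(n, i) rewritten as (i+1)/(n+1) C(n+1, i+1). The inductions on n
    for the sums below rest on this recurrence. *)
Lemma altbinS (R : realFieldType) n i :
  altbin R n.+1 i = altbin R n i + i.+1%:R / n.+1%:R * altbin R n.+1 i.
Proof.
rewrite /altbin.
have E : i.+1%:R / n.+1%:R * 'C(n.+1, i.+1)%:R = 'C(n, i)%:R :> R.
  by rewrite mulrAC -natrM -mul_bin_diag natrM mulrAC divff ?mul1r// pnatr_eq0.
by rewrite [X in _ + X]mulrA E binS natrD mulrDl.
Qed.

(** Expand (1 - 1)^(n+1) = 0 and isolate the term of index 0. *)
Lemma sum_altbin (R : realFieldType) n : \sum_(i < n.+1) altbin R n.+1 i = 1.
Proof.
have := exprDn (1 : R) (-1) n.+1; rewrite subrr expr0n/= big_ord_recl/=.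
under eq_bigr do rewrite expr1n mul1r /bump/= add1n exprS mulN1r mulNrn -mulr_natl.
rewrite bin0 expr0 expr1n mulr1 mulr1n sumrN => /eqP.
by rewrite eq_sym subr_eq0 => /eqP <-.
Qed.

Lemma sum_altbin_wide (R : realFieldType) n (F : nat -> R) :
  \sum_(i < n.+1) altbin R n i * F i = \sum_(i < n) altbin R n i * F i.
Proof. by rewrite big_ord_recr/= /altbin bin_small// !mul0r addr0. Qed.

(** [altbinS] divided by (i+1)^(k+1) and summed. One sum on the right has a smaller n, the other a
    smaller exponent, which sets up a double induction. *)
Lemma sum_altbin_exprVS (R : realFieldType) n k :
  \sum_(i < n.+1) altbin R n.+1 i / i.+1%:R ^+ k.+1 =
  \sum_(i < n) altbin R n i / i.+1%:R ^+ k.+1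
  + n.+1%:R^-1 * \sum_(i < n.+1) altbin R n.+1 i / i.+1%:R ^+ k.
Proof.
rewrite -(sum_altbin_wide n (fun i => (i.+1%:R ^+ k.+1)^-1)) mulr_sumr -big_split/=.
apply: eq_bigr => i _; rewrite {1}altbinS mulrDl; congr (_ + _).
have x0 : i.+1%:R != 0 :> R by rewrite pnatr_eq0.
have xk0 := expf_neq0 k x0; have y0 : n.+1%:R != 0 :> R by rewrite pnatr_eq0.
rewrite exprS; move: x0 xk0 y0.
set x := i.+1%:R; set y := n.+1%:R; set a := altbin _ _ _; set u := x ^+ k.
by move=> x0 u0 y0; field; rewrite u0 !nat1r y0.
Qed.

(** In the double induction, the recurrence adds a nonnegative term to a sum that is already at
    least 1; exponent 0 is [sum_altbin]. *)
Lemma sum_altbin_exprV_ge1 (R : realFieldType) n k :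
  1 <= \sum_(i < n.+1) altbin R n.+1 i / i.+1%:R ^+ k.
Proof.
elim: k n => [|k IHk] n.
  by under eq_bigr do rewrite expr0 divr1; rewrite sum_altbin.
elim: n => [|n IHn].
  by rewrite big_ord1 /altbin binn expr0 expr1n divr1 mulr1.
rewrite sum_altbin_exprVS (le_trans IHn)// lerDl mulr_ge0 ?invr_ge0//.
exact: le_trans ler01 (IHk n.+1).
Qed.

(** Passing to m terms adds 1/m^(k+2) on the left, but at least 1/m on the right by
    [sum_altbin_exprV_ge1]. At exponent 1 both sides would be the harmonic number. *)
Lemma sum_exprV_lt_altbin (R : realFieldType) n k :
  \sum_(i < n.+2) 1 / i.+1%:R ^+ k.+2 <
  \sum_(i < n.+2) altbin R n.+2 i / i.+1%:R ^+ k.+2.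
Proof.
have key m : 1 / m.+2%:R ^+ k.+2 <
    m.+2%:R^-1 * \sum_(i < m.+2) altbin R m.+2 i / i.+1%:R ^+ k.+1.
  rewrite div1r exprS invfM ltr_pM2l ?invr_gt0//.
  rewrite (lt_le_trans _ (sum_altbin_exprV_ge1 R m.+1 k.+1))//.
  by rewrite invf_lt1 ?exprn_gt0// exprn_egt1// ltr1n.
elim: n => [|n IHn].
  rewrite sum_altbin_exprVS [ltLHS]big_ord_recr/= ler_ltD//.
  by rewrite !big_ord1 /altbin binn expr0 mulr1 lexx.
rewrite sum_altbin_exprVS [ltLHS]big_ord_recr/= ltrD//; exact: key.
Qed.

Lemma prod_partial_fraction (R : realFieldType) n (s : R) : 0 <= s ->
  \prod_(i < n.+1) (1 + s / i.+1%:R)^-1 =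
  \sum_(i < n.+1) altbin R n.+1 i * (1 + s / i.+1%:R)^-1.
Proof.
move=> s0.
have pos i : 1 + s / i.+1%:R != 0 :> R.
  by rewrite gt_eqF// ltr_pwDl// divr_ge0.
elim: n => [|n IHn].
  by rewrite !big_ord1 /altbin binn expr0 mulr1 mul1r.
rewrite big_ord_recr/= IHn.
rewrite -(sum_altbin_wide n.+1 (fun i => (1 + s / i.+1%:R)^-1)).
apply: (mulIf (pos n.+1)); rewrite mulfVK// mulrDr mulr1.
(* The coefficients for [n.+1] are rewritten by [altbinS], then x / (1 + s/x) = x - s / (1 + s/x) is
   applied with x = i+1. *)
have -> : \sum_(i < n.+2) altbin R n.+1 i * (1 + s / i.+1%:R)^-1 =
    \sum_(i < n.+2) (altbin R n.+2 i * (1 + s / i.+1%:R)^-1)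
  + \sum_(i < n.+2) (s * altbin R n.+2 i / n.+2%:R * (1 + s / i.+1%:R)^-1)
  - n.+2%:R^-1 * \sum_(i < n.+2) (altbin R n.+2 i * i.+1%:R)
  :> R.
  rewrite mulr_sumr -sumrN -!big_split/=; apply: eq_bigr => i _.
  have := altbinS R n.+1 i.
  move/eqP; rewrite -subr_eq => /eqP <-.
  have si : i.+1%:R + s != 0 by rewrite gt_eqF// ltr_pwDl.
  have i0 : i.+1%:R != 0 :> R by rewrite pnatr_eq0.
  have n0 : n.+2%:R != 0 :> R by rewrite pnatr_eq0.
  move: si i0 n0 => /=; set x := i.+1%:R; set y := n.+2%:R; set a := altbin _ _ _.
  rewrite -/y; by move: x y a {IHn} => x y a si i0 n0; field; rewrite n0 i0.
(* The sum of the j c_j vanishes: summing [altbinS] makes it a multiple of the difference of two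
   coefficient sums, both equal to 1. *)
rewrite [X in _ - _ * X](_ : _ = 0); last first.
  have : \sum_(i < n.+2) altbin R n.+2 i =
      \sum_(i < n.+2) altbin R n.+1 i * 1
      + n.+2%:R^-1 * \sum_(i < n.+2) altbin R n.+2 i * i.+1%:R :> R.
    rewrite mulr_sumr -big_split/=; apply: eq_bigr => i _.
    by rewrite {1}altbinS mulr1; congr (_ + _); ring.
  rewrite (sum_altbin_wide n.+1 (fun=> 1)).
  under [X in _ = X + _]eq_bigr do rewrite mulr1.
  rewrite !sum_altbin => /eqP; rewrite addrC -subr_eq subrr eq_sym mulf_eq0.
  by rewrite invr_eq0 pnatr_eq0/= => /eqP.
rewrite mulr0 subr0; congr (_ + _).
by rewrite mulr_suml; apply: eq_bigr => i _; ring.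
Qed.

Lemma onem_prod_le (R : realFieldType) n (x : nat -> R) :
  (forall i, 0 <= x i <= 1) ->
  1 - \prod_(i < n) x i <= \sum_(i < n) (1 - x i).
Proof.
move=> x01; elim: n => [|n IHn]; first by rewrite !big_ord0 subrr.
have P01 : 0 <= \prod_(i < n) x i <= 1.
  by rewrite prodr_ge0 ?prodr_ile1// => i _; case/andP: (x01 i).
rewrite !big_ord_recr/=; move: IHn P01 (x01 n).
set p := \prod_(i < n) _; set q := \sum_(i < n) _; nra.
Qed.

(** Exchange the factors one at a time: w_i is the product of the x_j with j < i and of the y_j with
    j > i, so its distance to 1 is at most the sum of the defects of the factors. *)
Lemma prod_sub_telescope (R : realFieldType) n (x y : nat -> R) :
  (forall i, 0 <= x i <= 1) -> (forall i, 0 <= y i <= 1) ->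
  exists2 w : nat -> R,
    forall i, (i < n)%N ->
      0 <= w i <= 1 /\ 1 - w i <= \sum_(j < n) ((1 - x j) + (1 - y j)) &
    \prod_(i < n) x i - \prod_(i < n) y i = \sum_(i < n) w i * (x i - y i).
Proof.
move=> x01 y01; elim: n => [|n [w w01 wE]].
  by exists (fun=> 0) => //; rewrite !big_ord0 subrr.
have X01 : 0 <= \prod_(i < n) x i <= 1.
  by rewrite prodr_ge0 ?prodr_ile1// => i _; case/andP: (x01 i).
have X1 := onem_prod_le n x01.
have y1 : 0 <= \sum_(j < n) (1 - y j).
  by rewrite sumr_ge0// => j _; rewrite subr_ge0; case/andP: (y01 j).
exists (fun i => if (i < n)%N then w i * y n else \prod_(i < n) x i).
  move=> i; rewrite ltnS leq_eqVlt => /orP[/eqP ->|ltin].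
    rewrite ltnn; split=> //; rewrite big_ord_recr/= big_split/=.
    by have := x01 n; have := y01 n; lra.
  rewrite ltin big_ord_recr/=; have [wi wi1] := w01 i ltin.
  by have := x01 n; have := y01 n; split; nra.
rewrite !big_ord_recr/= ltnn.
under [X in _ = X + _]eq_bigr => i _ do rewrite ltn_ord mulrAC.
by rewrite -mulr_suml -wE; ring.
Qed.

(** The bound is global on [0, +oo[, so no radius has to be tracked under the rescalings t / j. *)
Definition taylor_at0 (R : realFieldType) (g : R -> R) (a : nat -> R) : Prop :=
  forall K, exists C : R, forall t : R, 0 <= t ->
    `|g t - \sum_(k < K) a k * t ^+ k| <= C * t ^+ K.

Lemma taylor_at0B (R : realFieldType) (g h : R -> R) a b :
  taylor_at0 g a -> taylor_at0 h b ->
  taylor_at0 (fun t => g t - h t) (fun k => a k - b k).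
Proof.
move=> ga hb K; have [C1 h1] := ga K; have [C2 h2] := hb K.
exists (C1 + C2) => t t0.
rewrite (_ : _ - _ = (g t - \sum_(k < K) a k * t ^+ k)
    - (h t - \sum_(k < K) b k * t ^+ k)); last first.
  rewrite (eq_bigr (fun k : 'I_K => a k * t ^+ k - b k * t ^+ k)) => [|k _].
    by rewrite sumrB; ring.
  by rewrite mulrBl.
by rewrite (le_trans (ler_normB _ _))// mulrDl lerD ?h1 ?h2.
Qed.

(** * Flatness at 0 and uniqueness for the functional equation *)

Section uniqueness.
Variables (R : archiRealFieldType) (n : nat) (D : R -> R) (d : nat -> R) (B : R).
Hypothesis D_taylor : taylor_at0 D d.
Hypotheses (d0 : d 0%N = 0) (d1 : d 1%N = 0).
Hypothesis D_eq : forall t : R, 0 <= t -> exists2 w : nat -> R,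
  forall i, (i < n.+2)%N -> 0 <= w i <= 1 /\ 1 - w i <= B * t &
  \sum_(i < n.+2) (altbin R n.+2 i - w i) * D (t / i.+1%:R) = 0.

Let div_bnd (t : R) i : 0 <= t -> 0 <= t / i.+1%:R <= t.
Proof.
by move=> t0; rewrite divr_ge0//= ler_pdivrMr// ler_peMr// ler1n.
Qed.

Let exp_div_bnd (t : R) i k : 0 <= t -> (t / i.+1%:R) ^+ k <= t ^+ k.
Proof.
by move=> t0; have /andP[? ?] := div_bnd i t0; rewrite lerXn2r ?nnegrE.
Qed.

Let coef_small k (C : R) : (forall t : R, 0 <= t -> `|d k| * t ^+ k <= C * t ^+ k.+1) ->
  d k = 0.
Proof.
move=> H; apply/eqP; rewrite -normr_eq0; apply/eqP/le_anti; rewrite normr_ge0 andbT.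
have C0 : 0 <= C.
  by have := H 1 ler01; rewrite !expr1n !mulr1; apply: le_trans.
rewrite leNgt; apply/negP => dk.
(* At this t the bound reads |d k| <= C / (C + 1) |d k|, which is absurd. *)
have t0 : 0 < `|d k| / (C + 1) by rewrite divr_gt0// ltr_wpDl.
have := H _ (ltW t0); rewrite exprS mulrA ler_pM2r ?exprn_gt0//.
by rewrite mulrCA ler_pMr// ler_pdivlMr ?mul1r ?ltr_wpDl// leNgt ltrDl ltr01.
Qed.

Lemma taylor_coef0 k : d k = 0.
Proof.
elim/ltn_ind: k => -[|[|k]] // IHk.
have [C1 hC1] := D_taylor k.+2; have [C2 hC2] := D_taylor k.+3.
have D1 t : 0 <= t -> `|D t| <= C1 * t ^+ k.+2.
  move=> t0; have := hC1 t t0; rewrite big1 ?subr0// => i _.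
  by rewrite IHk ?mul0r.
have D2 t : 0 <= t -> `|d k.+2 * t ^+ k.+2 - D t| <= C2 * t ^+ k.+3.
  move=> t0; have := hC2 t t0; rewrite big_ord_recr/= big1 ?add0r 1?distrC// => i _.
  by rewrite IHk ?mul0r.
have C10 : 0 <= C1 by have := D1 1 ler01; rewrite expr1n mulr1; apply: le_trans.
have C20 : 0 <= C2 by have := D2 1 ler01; rewrite !expr1n !mulr1; apply: le_trans.
pose c i := altbin R n.+2 i.
pose S := \sum_(i < n.+2) (c i - 1) / i.+1%:R ^+ k.+2.
have S0 : 0 < S.
  rewrite /S; under eq_bigr do rewrite mulrBl.
  by rewrite sumrB subr_gt0; exact: sum_exprV_lt_altbin.
apply: (@coef_small _ ((\sum_(i < n.+2) (`|c i - 1| * C2 + B * C1)) / S)) => t t0.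
rewrite mulrAC ler_pdivlMr//.
have [w w01 wE] := D_eq t0.
(* Subtracting the equation [wE] leaves two errors of order t^(k+3): the Taylor remainder, bounded
   by [D2], and the cost of replacing w by 1, bounded by B t times [D1]. *)
have -> : `|d k.+2| * t ^+ k.+2 * S = `|\sum_(i < n.+2)
    ((c i - 1) * (d k.+2 * (t / i.+1%:R) ^+ k.+2 - D (t / i.+1%:R))
     + (w i - 1) * D (t / i.+1%:R))|.
  rewrite -[in LHS](ger0_norm (exprn_ge0 _ t0)) -[S in LHS](gtr0_norm S0) -!normrM.
  congr `|_|; rewrite -[LHS]subr0 -[X in _ - X = _]wE mulr_sumr -sumrB.
  apply: eq_bigr => i _.
  by rewrite expr_div_n -/(c i); ring.
rewrite (le_trans (ler_norm_sum _ _ _))// mulr_suml ler_sum// => i _.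
have [/andP[wi0 wi1] wiB] := w01 i (ltn_ord i).
have /andP[ti0 ti1] := div_bnd i t0.
rewrite (le_trans (ler_normD _ _))// [leRHS]mulrDl lerD// normrM.
  rewrite -mulrA ler_wpM2l// (le_trans (D2 _ ti0))// ler_wpM2l//.
  exact: exp_div_bnd.
rewrite exprS mulrACA ler_pM//.
  by rewrite distrC ger0_norm ?subr_ge0.
rewrite (le_trans (D1 _ ti0))// ler_wpM2l//.
exact: exp_div_bnd.
Qed.

Lemma taylor_flat0 t : 0 <= t -> D t = 0.
Proof.
(* [A] bounds the sum of |c_j - w_j| over j >= 2, whatever the weights in [0, 1]. *)
pose A := \sum_(i < n.+1) (1 + `|altbin R n.+2 i.+1|).
have A0 : 0 <= A by rewrite sumr_ge0// => i _; rewrite addr_ge0.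
(* [K] is chosen so that A (s/2)^K <= s^K / 2. *)
pose K := Num.bound (2 * A).
have AK : 2 * A <= 2 ^+ K.
  rewrite ltW// (lt_le_trans (archi_boundP _)) ?mulr_ge0//.
  by rewrite -natrX ler_nat ltnW// ltn_expl.
have [C hC] := D_taylor K.
have D1 s : 0 <= s -> `|D s| <= C * s ^+ K.
  move=> s0; have := hC s s0; rewrite big1 ?subr0// => i _.
  by rewrite taylor_coef0 mul0r.
have C0 : 0 <= C by have := D1 1 ler01; rewrite expr1n mulr1; apply: le_trans.
(* One use of the equation halves the constant: as c_1 - w_1 >= 1, the value D s is controlled by
   the other terms, whose arguments are at most s/2. *)
have halve C' : 0 <= C' -> (forall s, 0 <= s -> `|D s| <= C' * s ^+ K) ->
    forall s, 0 <= s -> `|D s| <= (C' / 2) * s ^+ K.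
  move=> C'0 H s s0; have [w w01 wE] := D_eq s0.
  move: wE; rewrite big_ord_recl/= divr1 {1}/altbin bin1 expr0 mulr1.
  move/eqP; rewrite addr_eq0 => /eqP wE.
  have w0 : 1 <= n.+2%:R - w 0%N.
    have [/andP[_ w1] _] := w01 0%N isT.
    have : 1 <= n.+1%:R :> R by rewrite ler1n.
    by rewrite -[n.+2%:R]natr1; lra.
  have : `|D s| <= `|(n.+2%:R - w 0%N) * D s|.
    by rewrite normrM ler_peMl// ger0_norm// (le_trans ler01).
  move=> /le_trans; apply; rewrite wE normrN (le_trans (ler_norm_sum _ _ _))//.
  have : A * (C' * (s / 2) ^+ K) <= C' / 2 * s ^+ K.
    have -> : A * (C' * (s / 2) ^+ K) = A / 2 ^+ K * (C' * s ^+ K).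
      by rewrite expr_div_n; ring.
    have -> : C' / 2 * s ^+ K = 2^-1 * (C' * s ^+ K) by ring.
    rewrite ler_wpM2r ?mulr_ge0 ?exprn_ge0// ler_pdivrMr ?exprn_gt0//.
    by rewrite mulrC ler_pdivlMr// mulrC.
  apply: le_trans; rewrite /A mulr_suml ler_sum// => i _.
  rewrite normrM ler_pM//.
    have [/andP[wi0 wi1] _] := w01 i.+1 (ltn_ord (lift ord0 i)).
    rewrite /bump/= add1n (le_trans (ler_normB _ _))// addrC lerD//.
    by rewrite ger0_norm.
  have /andP[si0 _] := div_bnd i.+1 s0.
  rewrite /bump/= add1n (le_trans (H _ si0))// ler_wpM2l// lerXn2r ?nnegrE ?divr_ge0//.
  by rewrite ler_wpM2l// lef_pV2 ?posrE// ler_nat.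
have bnd m s : 0 <= s -> `|D s| <= (C / 2 ^+ m) * s ^+ K.
  elim: m s => [|m IHm] s s0; first by rewrite expr0 divr1 D1.
  by rewrite exprSr invfM mulrA; apply: halve => //; rewrite divr_ge0// exprn_ge0.
move=> t0; apply/eqP; rewrite -normr_eq0; apply/negPn/negP => Dt.
have Dt0 : 0 < `|D t| by rewrite lt0r Dt normr_ge0.
(* After m = [Num.bound Y] halvings, 2^m > Y and the bound C t^K / 2^m falls below |D t|. *)
pose Y := C * t ^+ K / `|D t|.
have Y0 : 0 <= Y by rewrite divr_ge0// mulr_ge0// exprn_ge0.
have := bnd (Num.bound Y) t t0.
rewrite mulrAC ler_pdivlMr ?exprn_gt0// mulrC -ler_pdivlMr// leNgt => /negP; apply.
rewrite (lt_le_trans (archi_boundP Y0))//.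
by rewrite -natrX ler_nat ltnW// ltn_expl.
Qed.

End uniqueness.

(** Apply [taylor_flat0] to g - h. The first-order coefficients must be matched by hypothesis: sum_j
    c_j / j = sum_j 1 / j, so the comparison of coefficients says nothing at order 1. *)
Lemma functional_equation_unique (R : archiRealFieldType) n (g h : R -> R)
    (a b : nat -> R) :
  (forall t : R, 0 <= t -> 0 <= g t <= 1) -> (forall t : R, 0 <= t -> 0 <= h t <= 1) ->
  (forall t : R, 0 <= t -> \prod_(i < n.+2) g (t / i.+1%:R) =
     \sum_(i < n.+2) altbin R n.+2 i * g (t / i.+1%:R)) ->
  (forall t : R, 0 <= t -> \prod_(i < n.+2) h (t / i.+1%:R) =
     \sum_(i < n.+2) altbin R n.+2 i * h (t / i.+1%:R)) ->
  taylor_at0 g a -> taylor_at0 h b ->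
  a 0%N = 1 -> b 0%N = 1 -> a 1%N = b 1%N ->
  forall t : R, 0 <= t -> g t = h t.
Proof.
move=> g01 h01 gE hE ga hb a0 b0 ab1 t t0; apply/eqP; rewrite -subr_eq0; apply/eqP.
have [C1 hC1] := ga 1%N; have [C2 hC2] := hb 1%N.
have C10 : 0 <= C1.
  by have := hC1 1 ler01; rewrite expr1 mulr1; apply: le_trans.
have C20 : 0 <= C2.
  by have := hC2 1 ler01; rewrite expr1 mulr1; apply: le_trans.
(* The Taylor bounds of order 1 control the defects 1 - g and 1 - h; summed over the n+2 factors
   they give the rate [B]. *)
have lip s : 0 <= s -> (1 - g s) + (1 - h s) <= (C1 + C2) * s.
  move=> s0; rewrite mulrDl; have := hC1 s s0; have := hC2 s s0.
  rewrite !big_ord1 !expr0 !mulr1 a0 b0 !expr1 !ler_norml => /andP[+ _] /andP[+ _].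
  by lra.
pose B := n.+2%:R * (C1 + C2).
apply: (@taylor_flat0 _ n (fun s => g s - h s) (fun k => a k - b k) B) => //.
- exact: taylor_at0B.
- by rewrite a0 b0 subrr.
- by rewrite ab1 subrr.
move=> s s0.
have si0 i : 0 <= s / i.+1%:R by rewrite divr_ge0.
have [w w01 wE] := @prod_sub_telescope R n.+2 _ _
  (fun i => g01 _ (si0 i)) (fun i => h01 _ (si0 i)).
exists w.
  move=> i /w01[wi wi1]; split=> //; apply: le_trans wi1 _.
  rewrite /B -mulrA mulr_natl -[X in _ *+ X]card_ord -sumr_const ler_sum// => j _.
  rewrite (le_trans (lip _ (si0 j)))// ler_wpM2l ?addr_ge0//.
  by rewrite ler_pdivrMr// ler_peMr// ler1n.
under eq_bigr do rewrite mulrBl mulrBr.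
rewrite sumrB -wE gE// hE//.
by rewrite sumrB subrr.
Qed.

(** The remainder of the geometric sum is exactly (-ct)^K / (1 + ct), with denominator at least
    1. *)
Lemma taylor_at0_inv1D (R : realFieldType) (c : R) : 0 <= c ->
  taylor_at0 (fun t : R => (1 + c * t)^-1) (fun k => (- c) ^+ k).
Proof.
move=> c0 K; exists (c ^+ K) => t t0.
have ct : 0 < 1 + c * t by rewrite ltr_pwDl// mulr_ge0.
have -> : (1 + c * t)^-1 - \sum_(k < K) (- c) ^+ k * t ^+ k
    = (- (c * t)) ^+ K / (1 + c * t).
  apply: (mulIf (lt0r_neq0 ct)); rewrite mulrBl mulVf ?divfK ?lt0r_neq0//.
  elim: K => [|K IHK]; first by rewrite big_ord0 mul0r subr0 expr0.
  rewrite big_ord_recr/= mulrDl opprD addrA IHK exprS -exprMn mulNr; ring.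
rewrite normrM normrX normrN !ger0_norm ?invr_ge0 ?mulr_ge0 ?(ltW ct)//.
rewrite exprMn ler_pdivrMr// ler_peMr ?mulr_ge0 ?exprn_ge0//.
by rewrite lerDl mulr_ge0.
Qed.

(** * Densities, independence and Laplace transforms *)

Section integral_weighted_comp.
Local Open Scope ereal_scope.
Context d d' (T : measurableType d) (T' : measurableType d') (R : realType).
Variables (mu : {measure set T -> \bar R}) (m : {measure set T' -> \bar R}).
Variables (Y : T -> T') (Z : T -> R).
Hypotheses (mY : measurable_fun setT Y) (mZ : measurable_fun setT Z).
Hypothesis Z_ge0 : forall x, (0 <= Z x)%R.
Hypothesis YZm : forall A, measurable A -> \int[mu]_(x in Y @^-1` A) (Z x)%:E = m A.

Import HBNNSimple.

Let integral_nnsfun_weighted (f : {nnsfun T' >-> R}) :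
  \int[mu]_x ((f (Y x))%:E * (Z x)%:E) = \int[m]_y (f y)%:E.
Proof.
have mf1 r : measurable_fun setT (fun x => \1_(f @^-1` [set r]) (Y x) : R).
  by apply: measurableT_comp => //.
rewrite integralT_nnsfun sintegralE.
under eq_integral => x _.
  rewrite fimfunE -fsumEFin// ge0_mule_fsuml; last first.
    by move=> r; exact: nnfun_muleindic_ge0.
  over.
rewrite ge0_integral_fsum//; last 2 first.
- move=> r; apply: emeasurable_funM; apply/measurable_EFinP => //.
  exact: measurable_funM.
- by move=> r x _; rewrite mule_ge0 ?lee_fin//; exact: nnfun_muleindic_ge0.
apply: eq_fsbigr => r; rewrite inE => -[y _ fyr].
have r0 : (0 <= r)%R by rewrite -fyr.
under eq_integral do rewrite EFinM -muleA.
have mA : measurable (f @^-1` [set r]) by [].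
rewrite ge0_integralZl//; last 2 first.
- by apply: emeasurable_funM; apply/measurable_EFinP.
- by move=> x _; rewrite mule_ge0// lee_fin.
congr (_ * _); rewrite -(YZm mA) [RHS]integral_mkcond; apply: eq_integral => x _.
rewrite patchE indicE; case: ifPn => /= h.
  by rewrite mem_set ?mul1e//; move: h; rewrite inE.
by rewrite memNset ?mul0e// => h'; move: h; rewrite notin_setE; apply.
Qed.

(** [YZm] says that m is the image under Y of the measure with density Z; simple functions and
    monotone convergence extend this from sets to h. Below, Z is in turn a probability density, a
    product of random factors and a scaling constant. *)
Lemma integral_weighted_comp (h : T' -> R) : measurable_fun setT h ->
  (forall y, (0 <= h y)%R) ->
  \int[mu]_x (h (Y x) * Z x)%:E = \int[m]_y (h y)%:E.
Proof.
move=> mh h0; have mEh : measurable_fun setT (EFin \o h) by exact/measurable_EFinP.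
pose f_ := nnsfun_approx measurableT mEh.
have f_cvg y : (f_ n y)%:E @[n --> \oo] --> (h y)%:E.
  by apply: (cvg_nnsfun_approx measurableT mEh) => // ? _; rewrite lee_fin.
have f_nd y m' n' : (m' <= n')%N -> (f_ m' y)%:E <= (f_ n' y)%:E.
  by move=> mn; rewrite lee_fin; exact/lefP/nd_nnsfun_approx.
have -> : \int[m]_y (h y)%:E = limn (fun n => \int[m]_y (f_ n y)%:E).
  rewrite -monotone_convergence//.
  - by apply: eq_integral => y _; apply/esym/cvg_lim => //; exact: f_cvg.
  - by move=> n; apply/measurable_EFinP.
  - by move=> n y _; rewrite lee_fin.
  - by move=> y _ i j ij; exact: f_nd.
under [in RHS]eq_fun do rewrite -integral_nnsfun_weighted.
rewrite -monotone_convergence//.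
- apply: eq_integral => x _; apply/esym/cvg_lim => //.
  by rewrite EFinM; apply: cvgeZr => //; exact: f_cvg.
- move=> n; apply: emeasurable_funM; apply/measurable_EFinP => //.
  exact: measurableT_comp.
- by move=> n x _; rewrite mule_ge0// lee_fin.
- by move=> x _ i j ij; rewrite lee_wpmul2r ?lee_fin ?Z_ge0//; exact: f_nd.
Qed.

End integral_weighted_comp.

(* [filterS] fails to find the filter instance when the measure is Lebesgue's. *)
Lemma ae_imply d (T : semiRingOfSetsType d) (R : realType)
    (mu : {measure set T -> \bar R}) (P Q : T -> Prop) :
  (forall x, P x -> Q x) -> {ae mu, forall x, P x} -> {ae mu, forall x, Q x}.
Proof.
move=> PQ [N [mN N0 sub]]; exists N; split => // x /= nQ.
by apply: sub => /= /PQ.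
Qed.

(** * Integration against a density *)

Section density.
Local Open Scope ereal_scope.
Context (R : realType) (m : probability R R) (g : R -> R).
Local Notation mu := (@lebesgue_measure R).
Hypothesis mg : measurable_fun setT g.
Hypothesis gE : forall A : set R, measurable A -> m A = \int[mu]_(x in A) (g x)%:E.

(** On A = {g < 0} the integral of g is both m A >= 0 and minus the integral of |g|, so the latter
    is 0. *)
Lemma density_ae_ge0 : {ae mu, forall x, (0 <= g x)%R}.
Proof.
pose A := [set x | (g x < 0)%R].
have mA : measurable A.
  have := mg measurableT (measurable_itv `]-oo, 0%R[); rewrite setTI.
  by congr measurable; apply/seteqP; split => x /=; rewrite in_itv.
have mgA : measurable_fun A (EFin \o g).
  by apply/measurable_EFinP; apply: measurable_funTS.
have A0 : \int[mu]_(x in A) `|(EFin \o g) x| = 0.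
  have mAE : m A = - \int[mu]_(x in A) `|(EFin \o g) x|.
    rewrite gE// -integral_ge0N//; apply: eq_integral => x; rewrite inE => Ax /=.
    by rewrite ltr0_norm// opprK.
  apply/eqP; rewrite eq_le; apply/andP; split; last exact: integral_ge0.
  by rewrite -oppe_ge0 -mAE.
have /ae_eq_integral_abs := A0 => /(_ mA mgA)[N [mN N0 sub]].
exists N; split => // x /= /negP; rewrite -ltNge => gx0; apply: sub => /=.
move=> /(_ gx0) [] gx; by rewrite gx ltxx in gx0.
Qed.

Lemma integral_density (h : R -> R) : measurable_fun setT h ->
  (forall x, (0 <= h x)%R) ->
  \int[m]_x (h x)%:E = \int[mu]_x (h x * g x)%:E.
Proof.
(* [integral_weighted_comp] wants a weight that is nonnegative everywhere, so g gives way to its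
   positive part, equal to it almost everywhere. *)
move=> mh h0; have mg' : measurable_fun setT (g \max cst 0)%R.
  by apply: measurable_maxr.
have aeg : {ae mu, forall x, (g \max cst 0)%R x = g x}.
  apply: ae_imply density_ae_ge0 => x gx /=.
  by rewrite /cst; apply/max_idPl.
have Zg (A : set R) : measurable A ->
    \int[mu]_(x in idfun @^-1` A) ((g \max cst 0)%R x)%:E = m A.
  move=> mA; apply: etrans (esym (gE mA)); apply: ae_eq_integral => //.
  + by apply/measurable_EFinP; apply: measurable_funTS.
  + by apply/measurable_EFinP; apply: measurable_funTS.
  + by apply: ae_imply aeg => x /= -> _.
have Z0 x : (0 <= (g \max cst 0)%R x)%R by rewrite /= le_max lexx orbT.
have mid : measurable_fun setT (idfun : measurableTypeR R -> R).
  exact: measurable_id.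
apply: etrans (esym (integral_weighted_comp (mu := mu) mid mg' Z0 Zg mh h0)) _.
apply: ae_eq_integral => //.
- by apply/measurable_EFinP; apply: measurable_funM.
- by apply/measurable_EFinP; apply: measurable_funM.
- by apply: ae_imply aeg => x /= -> _.
Qed.

Lemma integrable_density : mu.-integrable setT (EFin \o g).
Proof.
have mEg : measurable_fun setT (EFin \o g) by apply/measurable_EFinP.
apply/integrableP; split=> //.
have -> : \int[mu]_x `|(EFin \o g) x| = m setT; last by rewrite probability_setT ltry.
apply: etrans (esym (gE measurableT)); apply: ae_eq_integral => //.
- exact: measurableT_comp.
- by apply: ae_imply density_ae_ge0 => x gx _ /=; rewrite ger0_norm.
Qed.

Lemma density_set1 r : m [set r] = 0.
Proof. by rewrite gE// integral_set1. Qed.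

End density.

(** * Expectation of a product of independent factors *)

Section product_expectation.
Local Open Scope ereal_scope.
Context d (T : measurableType d) (R : realType) (P : probability T R) (I : finType).
Variables (X : I -> {RV P >-> R}) (g : I -> R -> R).
Hypothesis X_indep : mutually_independent X.
Hypothesis mg : forall i, measurable_fun setT (g i).
Hypothesis g_ge0 : forall i x, (0 <= g i x)%R.
Hypothesis g_fin : forall i, \int[P]_w (g i (X i w))%:E < +oo.

Let mgX i : measurable_fun setT (fun w => g i (X i w)).
Proof. exact: measurableT_comp. Qed.

Let m1X i (A : set R) : measurable A ->
  measurable_fun setT (fun w => \1_A (X i w) : R).
Proof.
by move=> mA; exact: (measurableT_comp (measurable_indic mA)).
Qed.

(** This interpolates between independence of events ([s] empty) and the product formula ([s] full):
    indices in [s] carry a function, the others an indicator. Induction on [s] converts one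
    indicator at a time. *)
Let integral_partial (s : seq I) (A : I -> set R) : uniq s ->
  (forall i, measurable (A i)) ->
  \int[P]_w (\prod_i (if i \in s then g i (X i w) else \1_(A i) (X i w)))%:E =
  (\prod_i (if i \in s then fine (\int[P]_w (g i (X i w))%:E)
            else fine (P (X i @^-1` A i))))%:E.
Proof.
elim: s A => [|o s IHs] A /=.
  move=> _ mA; pose C := \bigcap_(i in [set` [set: I]%SET]) (X i @^-1` A i).
  have mXA i : measurable (X i @^-1` A i).
    by rewrite -[X in measurable X]setTI; exact: measurable_funP.
  have mC : measurable C by apply: fin_bigcap_measurable.
  transitivity (\int[P]_w (\1_C w)%:E).
    apply: eq_integral => w _; congr (_%:E); rewrite indicE.
    have [wC|wC] := pselect (C w).
      rewrite mem_set// big1// => i _; rewrite indicE mem_set//.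
      by apply: wC => /=; rewrite finset.in_setT.
    have [i _ wi] : exists2 i, [set` [set: I]%SET] i & ~ A i (X i w).
      by move: wC => /existsNP[i /not_implyP[? ?]]; exists i.
    by rewrite [w \in C]memNset// (bigD1 i)//= indicE memNset// mul0r.
  rewrite integral_indic// setIT; apply: etrans (X_indep [set: I]%SET mA) _.
  rewrite -prodEFin; apply: eq_big => [i|i _]; first by rewrite finset.in_setT.
  by rewrite fineK// fin_num_measure.
move=> /andP[os us] mA.
pose Z w := (\prod_(i | i != o)
  (if i \in s then g i (X i w) else \1_(A i) (X i w)))%R.
pose c := (\prod_(i | i != o) (if i \in s then fine (\int[P]_w (g i (X i w))%:E)
            else fine (P (X i @^-1` A i))))%R.
have c0 : (0 <= c)%R.
  apply: prodr_ge0 => i _; case: ifP => _; apply: fine_ge0 => //.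
  by apply: integral_ge0 => w _; rewrite lee_fin.
have Z0 w : (0 <= Z w)%R.
  by apply: prodr_ge0 => i _; case: ifP => _.
have mZ : measurable_fun setT Z.
  rewrite (_ : Z = fun w => (\prod_(i <- [seq i <- index_enum I | i != o])
      (if i \in s then g i (X i w) else \1_(A i) (X i w)))%R); last first.
    by apply/funext => w; rewrite big_filter.
  by apply: measurable_prod => i _; case: (i \in s); [exact: mgX|exact: m1X].
(* The image under [X o] of the measure with density [Z] should be c times the law of [X o]. *)
have key := integral_weighted_comp (mu := P) (Y := X o) (Z := Z)
  (m := mscale (NngNum c0) (distribution P (X o))).
transitivity (\int[P]_w (g o (X o w) * Z w)%:E).
  apply: eq_integral => w _; congr (_%:E); rewrite (bigD1 o)//= mem_head; congr (_ * _)%R.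
  by apply: eq_bigr => i io; rewrite inE (negbTE io).
rewrite {}key//.
- rewrite ge0_integral_mscale//=; last first.
    by move=> x _; rewrite lee_fin.
    exact/measurable_EFinP.
  rewrite (bigD1 o)//= mem_head mulrC EFinM; congr (_ * _).
    congr (_%:E); apply: eq_bigr => i io; by rewrite inE (negbTE io).
  rewrite ge0_integral_distribution;
    [|exact: measurableT_comp|by move=> y; rewrite lee_fin].
  by rewrite fineK// ge0_fin_numE ?g_fin// integral_ge0// => w _; rewrite lee_fin.
move=> B mB.
(* The hypothesis of [key] on a Borel set [B] is the induction hypothesis with [A o] replaced by
   [B]. *)
have mA' i : measurable (if i == o then B else A i) by case: ifP.
have := IHs (fun i => if i == o then B else A i) us mA'.
rewrite (bigD1 o)//= (negbTE os) eqxx mulrC EFinM fineK; last first.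
  by rewrite fin_num_measure// -[X in measurable X]setTI; exact: measurable_funP.
rewrite (eq_bigr (fun i => if i \in s then fine (\int[P]_w (g i (X i w))%:E)
    else fine (P (X i @^-1` A i)))) => [|i io]; last by rewrite (negbTE io).
move=> E; apply: etrans _ E; rewrite integral_mkcond; apply: eq_integral => w _.
rewrite (bigD1 o)//= (negbTE os) eqxx patchE indicE.
rewrite (eq_bigr (fun i => if i \in s then g i (X i w) else \1_(A i) (X i w)))
  => [|i io]; last by rewrite (negbTE io).
rewrite -/(Z w); have [h|h] := boolP (w \in _).
  by rewrite mem_set ?mul1r//; move: h; rewrite inE.
by rewrite memNset ?mul0r// => h'; move: h; rewrite notin_setE; apply.
Qed.

Lemma integral_prod_indep :
  \int[P]_w (\prod_i g i (X i w))%:E =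
  (\prod_i fine (\int[P]_w (g i (X i w))%:E))%:E.
Proof.
have := @integral_partial (enum I) (fun=> setT) (enum_uniq I) (fun=> measurableT).
under eq_integral do under eq_bigr do rewrite mem_enum inE.
by under [in X in _ = X -> _]eq_bigr do rewrite mem_enum inE.
Qed.

End product_expectation.

(** * The Laplace transform on the half-line *)

Section laplace.
Context (R : realType).
Implicit Types (m : probability R R) (t : R).

(** Integrating over [0, +oo[ only keeps the value in [0, 1] for every probability and every t >= 0,
    without a condition on the support. *)
Definition laplace m t : R :=
  fine (\int[m]_(x in `[0%R, +oo[) (expR (- (t * x)))%:E).

Lemma measurable_expRN t : measurable_fun setT (fun x : R => expR (- (t * x))).
Proof.
by apply: measurableT_comp => //; apply: measurableT_comp => //; exact: measurable_funM.
Qed.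

Lemma integral_expRN_le1 m t : 0 <= t ->
  (\int[m]_(x in `[0%R, +oo[) (expR (- (t * x)))%:E <= 1)%E.
Proof.
move=> t0; apply: (@le_trans _ _ (\int[m]_(x in `[0%R, +oo[) (cst 1 x))%E).
  apply: ge0_le_integral => //.
  - by apply/measurable_EFinP/measurable_funTS; exact: measurable_expRN.
  - move=> x; rewrite /= in_itv/= andbT => x0.
    by rewrite lee_fin -expR0 ler_expR oppr_le0 mulr_ge0.
by rewrite integral_cst// mul1e probability_le1.
Qed.

Lemma laplace_fin_num m t : 0 <= t ->
  (laplace m t)%:E = (\int[m]_(x in `[0%R, +oo[) (expR (- (t * x)))%:E)%E.
Proof.
move=> t0; rewrite /laplace fineK// ge0_fin_numE.
  by rewrite (le_lt_trans (integral_expRN_le1 m t0))// ltry.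
by apply: integral_ge0 => x _; rewrite lee_fin expR_ge0.
Qed.

Lemma laplace_01 m t : 0 <= t -> 0 <= laplace m t <= 1.
Proof.
move=> t0; rewrite -!lee_fin laplace_fin_num// integral_expRN_le1// andbT.
by apply: integral_ge0 => x _; rewrite lee_fin expR_ge0.
Qed.

End laplace.

(** * Scaling of Lebesgue integrals *)

Section lebesgue_scaling.
Local Open Scope ereal_scope.
Context (R : realType) (c : R) (c_gt0 : (0 < c)%R).
Local Notation mu := (@lebesgue_measure R).

(** By uniqueness of Lebesgue measure, it suffices to compute the rescaled image measure on the
    intervals ]a, b]. *)
Lemma lebesgue_measure_scale (A : set R) : measurable A ->
  mu A = c%:E * mu ( *%R c @^-1` A).
Proof.
move=> mA.
suff -> : mu A = pushforward (mscale (NngNum (ltW c_gt0)) mu)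
    ( *%R c : _ -> measurableTypeR R) A by [].
apply: lebesgue_measure_unique => //= _ [[a b]] _ <-.
rewrite /pushforward/= /mscale/=.
have -> : *%R c @^-1` `]a, b] = `](a / c)%R, (b / c)%R]%classic.
  apply/seteqP; split => x /=; rewrite !in_itv/=;
  by rewrite ltr_pdivrMr// ler_pdivlMr// mulrC.
rewrite !lebesgue_measure_itv/= !lte_fin ltr_pM2r ?invr_gt0//.
case: ifPn => ab; last by rewrite mule0.
by rewrite -!EFinB -EFinM -mulrBl mulrCA divff ?mulr1// gt_eqF.
Qed.

End lebesgue_scaling.

Section lebesgue_scaling_integral.
Local Open Scope ereal_scope.
Context (R : realType) (c : R) (c_gt0 : (0 < c)%R).
Local Notation mu := (@lebesgue_measure R).
Local Notation D := (`[0%R, +oo[%classic : set R).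

Lemma ge0_integral_scale (F : R -> R) :
  measurable_fun setT F -> (forall x, (0 <= F x)%R) ->
  c%:E * \int[mu]_(x in D) (F (c * x)%R)%:E = \int[mu]_(x in D) (F x)%:E.
Proof.
move=> mF F0; have mFD : measurable_fun setT (F \_ D).
  by apply/measurable_restrict => //; exact: measurable_funTS.
have FD0 x : (0 <= (F \_ D) x)%R by rewrite patchE; case: ifP.
rewrite -ge0_integralZl//; last 3 first.
- by apply/measurable_EFinP/measurable_funTS; apply: measurableT_comp.
- by move=> x _; rewrite lee_fin.
- by rewrite lee_fin ltW.
rewrite integral_mkcond [RHS]integral_mkcond.
rewrite [RHS](_ : _ = \int[mu]_x ((F \_ D) x)%:E); last first.
  by apply: eq_integral => x _; rewrite !patchE; case: ifP.
have YZ (A : set R) : measurable A ->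
    \int[mu]_(x in *%R c @^-1` A) (cst c x)%:E = mu A.
  move=> mA; apply: etrans (integral_cst mu _ c%:E) _; last first.
    by rewrite [RHS](lebesgue_measure_scale c_gt0).
  by rewrite -[X in measurable X]setTI; exact: measurable_funM.
have mc : measurable_fun setT ( *%R c) by exact: measurable_funM.
apply: etrans _ (integral_weighted_comp (mu := mu) (m := mu) mc (measurable_cst c)
  (fun=> ltW c_gt0) YZ mFD FD0).
apply: eq_integral => x _; have cxD : (c * x \in D)%R = (x \in D).
  by apply/idP/idP; rewrite !inE/= !in_itv/= !andbT pmulr_rge0.
by rewrite !patchE cxD; case: ifP; rewrite ?mul0r// muleC.
Qed.

(** Positive and negative parts are scaled separately; signs matter because [F] will contain the
    density [f], nonnegative only almost everywhere. *)
Lemma integral_scale (F : R -> R) :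
  measurable_fun setT F -> mu.-integrable D (EFin \o F) ->
  mu.-integrable D (fun x => (F (c * x)%R)%:E) /\
  c%:E * \int[mu]_(x in D) (F (c * x)%R)%:E = \int[mu]_(x in D) (F x)%:E.
Proof.
move=> mF iF.
have mFc : measurable_fun D (fun x => (F (c * x)%R)%:E).
  by apply/measurable_EFinP/measurable_funTS; apply: measurableT_comp.
have iFc : mu.-integrable D (fun x => (F (c * x)%R)%:E).
  apply/integrableP; split => //.
  have mnF : measurable_fun setT (fun x => `|F x|%R) by apply: measurableT_comp.
  have E := ge0_integral_scale mnF (fun=> normr_ge0 _).
  rewrite -(@lte_pmul2l _ c%:E)// mulry gtr0_sg// mul1e.
  have -> : c%:E * \int[mu]_(x in D) `|(F (c * x)%R)%:E| =
      \int[mu]_(x in D) `|(EFin \o F) x|.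
    exact: E.
  by have /integrableP[] := iF.
split => //.
have part (G : R -> R) : measurable_fun setT G ->
    c%:E * \int[mu]_(x in D) (Num.max (G (c * x)) 0)%:E =
    \int[mu]_(x in D) (Num.max (G x) 0)%:E.
  move=> mG; have mG0 : measurable_fun setT (fun x => Num.max (G x) 0%R).
    exact: measurable_maxr.
  have G0 x : (0 <= Num.max (G x) 0)%R by rewrite le_max lexx orbT.
  exact: (ge0_integral_scale mG0 G0).
have posE (G : R -> R) : \int[mu]_(x in D) (EFin \o G)^\+ x =
    \int[mu]_(x in D) (Num.max (G x) 0)%:E.
  by apply: eq_integral => x _; rewrite funeposE EFin_max.
have negE (G : R -> R) : \int[mu]_(x in D) (EFin \o G)^\- x =
    \int[mu]_(x in D) (Num.max (- G x)%R 0)%:E.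
  by apply: eq_integral => x _; rewrite funenegE EFin_max EFinN.
rewrite integralE (posE (fun x => F (c * x)%R)) (negE (fun x => F (c * x)%R)).
rewrite [RHS]integralE posE negE muleBr//; last first.
  by apply: fin_num_adde_defl; rewrite fin_numN -negE; exact: integrable_neg_fin_num.
have mNF : measurable_fun setT (\- F)%R by exact: measurableT_comp.
by rewrite (part F mF) (part _ mNF).
Qed.

End lebesgue_scaling_integral.

(** * The functional equation for the Laplace transform *)

Section laplace_functional_equation.
Local Open Scope ereal_scope.
Context (R : realType) (nu : probability R R) (f : R -> R).
Local Notation mu := (@lebesgue_measure R).
Local Notation D := (`[0%R, +oo[%classic : set R).
Hypothesis mf : measurable_fun setT f.
Hypothesis fE : forall A : set R, measurable A -> nu A = \int[mu]_(x in A) (f x)%:E.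
Hypothesis nu_lt0 : nu `]-oo, 0%R[%classic = 0.

Lemma integral_nonneg_support (h : R -> R) : measurable_fun setT h ->
  (forall x, (0 <= h x)%R) ->
  \int[nu]_x (h x)%:E = \int[nu]_(x in D) (h x)%:E.
Proof.
move=> mh h0.
rewrite (@ge0_negligible_integral _ _ _ nu setT `]-oo, 0%R[)//.
- congr (integral _ _ _); rewrite setTD; apply/seteqP.
  split => x /=; rewrite !in_itv/= andbT.
    by move/negP; rewrite -leNgt.
  by move=> x0; apply/negP; rewrite -leNgt.
- exact/measurable_EFinP.
- by move=> x _; rewrite lee_fin.
Qed.

Lemma laplace_density (t : R) : (0 <= t)%R ->
  mu.-integrable D (fun x => (expR (- (t * x)) * f x)%:E) /\
  (laplace nu t)%:E = \int[mu]_(x in D) (expR (- (t * x)) * f x)%:E.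
Proof.
move=> t0; have me := measurable_expRN t; split.
  apply: (@le_integrable _ _ _ mu D _ _ (EFin \o f)) => //.
  - by apply/measurable_EFinP/measurable_funTS; exact: measurable_funM.
  - move=> x; rewrite /= in_itv/= andbT => x0; rewrite lee_fin normrM ler_piMl//.
    by rewrite ger0_norm ?expR_ge0// -expR0 ler_expR oppr_le0 mulr_ge0.
  - by apply: (integrableS measurableT) => //; exact: integrable_density mf fE.
rewrite laplace_fin_num// integral_mkcond [RHS]integral_mkcond.
pose h := (fun x => expR (- (t * x))) \_ D.
transitivity (\int[nu]_x (h x)%:E).
  by apply: eq_integral => x _; rewrite /h !patchE; case: ifP.
rewrite (integral_density mf fE).
- by apply: eq_integral => x _; rewrite /h !patchE; case: ifP => //; rewrite mul0r.
- by apply/measurable_restrict => //; exact: measurable_funTS.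
- by move=> x; rewrite /h patchE; case: ifP => // _; exact: expR_ge0.
Qed.

Context (n : nat) d (T : measurableType d) (P : probability T R)
  (Xs : 'I_n -> {RV P >-> R}).
Hypothesis Xs_indep : mutually_independent Xs.
Hypothesis Xs_nu : forall i (A : set R), measurable A -> distribution P (Xs i) A = nu A.
Hypothesis sum_density : has_density P
  (fun w => \sum_(i < n) (i.+1%:R)^-1 * Xs i w)%R
  (fun x => if 0 <= x then \sum_(i < n) altbin R n i * i.+1%:R * f (i.+1%:R * x)
            else 0)%R.

Let integral_Xs (t : R) i : (0 <= t)%R ->
  \int[P]_w (expR (- (t * Xs i w)))%:E = (laplace nu t)%:E.
Proof.
move=> t0; rewrite laplace_fin_num// -integral_nonneg_support; last 2 first.
- exact: measurable_expRN.
- by move=> x; exact: expR_ge0.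
transitivity (\int[distribution P (Xs i)]_x (expR (- (t * x)))%:E).
  rewrite ge0_integral_distribution//.
  by apply/measurable_EFinP; exact: measurable_expRN.
apply: (eq_measure_integral nu) => A mA _.
exact: Xs_nu.
Qed.

Let S w := (\sum_(i < n) (i.+1%:R)^-1 * Xs i w)%R.

Let mS : measurable_fun setT S.
Proof. by apply: measurable_sum => i; exact: measurable_funM. Qed.

HB.instance Definition _ := isMeasurableFun.Build _ _ _ _ S mS.

(** The transform of the weighted sum is computed twice: by independence it is a product; from the
    density, the substitution y = jx turns j e^(-tx) f(jx) dx into e^(-(t/j)y) f(y) dy. *)
Lemma laplace_functional_equation (t : R) : (0 <= t)%R ->
  (\prod_(i < n) laplace nu (t / i.+1%:R) =
   \sum_(i < n) altbin R n i * laplace nu (t / i.+1%:R))%R.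
Proof.
move=> t0; have ti0 i : (0 <= t / i.+1%:R)%R by rewrite divr_ge0.
apply: EFin_inj; transitivity (\int[P]_w (expR (- (t * S w)))%:E).
  under eq_integral => w _.
    have -> : expR (- (t * S w)) =
        (\prod_(i < n) expR (- (t / i.+1%:R * Xs i w)))%R.
      rewrite -expR_sum sumrN; congr (expR (- _)).
      by rewrite /S mulr_sumr; apply: eq_bigr => i _; rewrite mulrA.
    over.
  have := integral_prod_indep
    (g := fun (i : 'I_n) x => expR (- (t / i.+1%:R * x))) Xs_indep.
  move=> ->.
  - by congr EFin; apply: eq_bigr => i _; rewrite integral_Xs.
  - by move=> i; exact: measurable_expRN.
  - by move=> i x; exact: expR_ge0.
  - by move=> i; rewrite integral_Xs// ltry.
have [mg gE] := sum_density.
transitivity (\int[distribution P S]_x (expR (- (t * x)))%:E).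
  rewrite ge0_integral_distribution//.
  by apply/measurable_EFinP; exact: measurable_expRN.
rewrite (integral_density (m := distribution P S) mg gE); last 2 first.
- exact: measurable_expRN.
- by move=> x; exact: expR_ge0.
pose F (i : 'I_n) (x : R) := (expR (- (t / i.+1%:R * x)) * f x)%R.
transitivity (\int[mu]_(x in D) (\sum_(i < n)
    (altbin R n i * i.+1%:R)%:E * (F i (i.+1%:R * x)%R)%:E)).
  rewrite [RHS]integral_mkcond; apply: eq_integral => x _; rewrite patchE.
  have -> : (x \in D) = (0 <= x)%R.
    by apply/idP/idP; rewrite inE/= in_itv/= andbT.
  case: ifP; rewrite ?mulr0// => _.
  under [RHS]eq_bigr do rewrite -EFinM.
  rewrite sumEFin mulr_sumr; congr EFin; apply: eq_bigr => i _.
  rewrite /F mulrA divfK ?pnatr_eq0//; ring.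
have FE i := integral_scale (ltr0Sn R i)
  (measurable_funM (measurable_expRN (t / i.+1%:R)) mf)
  (proj1 (laplace_density (ti0 i))).
rewrite integral_sum//; last first.
  by move=> i; apply: integrableZl => //; exact: (proj1 (FE i)).
rewrite -sumEFin; apply: eq_bigr => i _.
rewrite integralZl//; last exact: (proj1 (FE i)).
rewrite EFinM -muleA (proj2 (FE i)) [RHS]EFinM; congr (_ * _).
by rewrite -(proj2 (laplace_density (ti0 i))).
Qed.

End laplace_functional_equation.

(** * Taylor expansion of the Laplace transform *)

Section expRN_remainder.
Context (R : realType).
Implicit Types (y : R) (K : nat).

(* [expRN_rem K y] is (-1)^K times the K-th Taylor remainder of e^(-y) at 0. *)
Fixpoint expRN_rem K y : R :=
  if K is K'.+1 then y ^+ K' / K'`!%:R - expRN_rem K' y else expR (- y).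

(** The sign built into [expRN_rem] makes each remainder exactly the derivative of the next. *)
Lemma is_derive_expRN_rem K y : is_derive y 1 (expRN_rem K.+1) (expRN_rem K y).
Proof.
have remE k : expRN_rem k.+1 = k`!%:R^-1 \*: (id ^+ k : R -> R) - expRN_rem k.
  by apply/funext => z; rewrite !fctE /= mulrC.
elim: K y => [|K IHK] y.
  have d0 : is_derive y 1 (expRN_rem 0) (- expR (- y)).
    rewrite -mulrN1; exact: (is_derive1_comp (f := expR) (g := -%R)).
  rewrite remE; apply: is_derive_eq.
  by rewrite scaler0 sub0r opprK.
rewrite remE; apply: is_derive_eq.
rewrite /= factS natrM invfM /GRing.scale/= mulr1; congr (_ - _).
by rewrite -mulrA (mulrCA K`!%:R^-1) mulKf ?pnatr_eq0// mulrC.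
Qed.

(** The remainder of order K+1 vanishes at 0 and its derivative, the remainder of order K, is
    nonnegative: apply the mean value theorem. *)
Lemma expRN_rem_ge0 K y : 0 <= y -> 0 <= expRN_rem K y.
Proof.
elim: K y => [|K IHK] y y0; first exact: expR_ge0.
have rem0 : expRN_rem K.+1 0 = 0.
  elim: {IHK} K => [|K IHK]; first by rewrite /= oppr0 expR0 expr0 fact0 divr1 subrr.
  by rewrite [LHS]/= -/(expRN_rem K.+1 0) IHK expr0n/= mul0r subr0.
have [c c0y] : exists2 c, c \in `[0, y] &
    expRN_rem K.+1 y - expRN_rem K.+1 0 = expRN_rem K c * (y - 0).
  apply: MVT_segment => // [x _|]; first exact: is_derive_expRN_rem.
  apply: continuous_subspaceT => x; apply: differentiable_continuous.
  by apply/derivable1_diffP; apply: ex_derive; exact: is_derive_expRN_rem.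
rewrite rem0 !subr0 => ->; rewrite mulr_ge0// IHK//.
by move: c0y; rewrite in_itv/= => /andP[].
Qed.

(** This is the nonnegativity of the next remainder. *)
Lemma expRN_rem_le K y : 0 <= y -> expRN_rem K y <= y ^+ K / K`!%:R.
Proof. by move=> y0; have := expRN_rem_ge0 K.+1 y0; rewrite /= subr_ge0. Qed.

Lemma measurable_expRN_rem K : measurable_fun setT (expRN_rem K).
Proof.
elim: K => [|K IHK] /=; first exact: measurableT_comp.
by apply: measurable_funB => //; apply: measurable_funM => //; exact: measurable_funX.
Qed.

End expRN_remainder.

(** * Moments as Taylor coefficients *)

Section laplace_taylor.
Context (R : realType) (nu : probability R R) (s : R).
Local Notation D := (`[0%R, +oo[%classic : set R).
Hypothesis s_gt0 : 0 < s.
Hypothesis exp_moment : (\int[nu]_(x in D) (expR (s * x))%:E < +oo)%E.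

Definition moment k : R := \int[nu]_(x in D) (x ^+ k).

Let in_D x : D x -> 0 <= x.
Proof. by rewrite /= in_itv/= andbT. Qed.

(** Since (s x)^k / k! <= e^(s x), one exponential moment dominates every power. *)
Lemma integrable_moment k : nu.-integrable D (fun x => (x ^+ k)%:E).
Proof.
have mexp : measurable_fun setT (fun x : R => expR (s * x)).
  by apply: measurableT_comp => //; exact: measurable_funM.
have iexp : nu.-integrable D (fun x => (expR (s * x))%:E).
  apply/integrableP; split.
    by apply/measurable_EFinP; exact: measurable_funTS.
  by under eq_integral do rewrite /= ger0_norm ?expR_ge0//.
apply: (@le_integrable _ _ _ nu D _ _
  (fun x => (k`!%:R / s ^+ k)%:E * (expR (s * x))%:E)%E) => //.
- by apply/measurable_EFinP/measurable_funTS; exact: measurable_funX.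
- move=> x /in_D x0; rewrite -EFinM /= lee_fin !ger0_norm ?exprn_ge0//; last first.
    by rewrite mulr_ge0 ?expR_ge0// divr_ge0// exprn_ge0// ltW.
  have sx0 : 0 <= s * x by rewrite mulr_ge0// ltW.
  rewrite mulrAC ler_pdivlMr ?exprn_gt0// -exprMn.
  rewrite (mulrC x) (mulrC k`!%:R) -ler_pdivrMr ?ltr0n ?fact_gt0//; case: k => [|k].
    by rewrite expr0 fact0 divr1 -expR0 ler_expR.
  by rewrite (le_trans _ (expR_ge1Dxn k sx0))// lerDr.
- exact: integrableZl.
Qed.

Lemma moment_ge0 k : 0 <= moment k.
Proof. by apply: Rintegral_ge0 => x /in_D x0; rewrite exprn_ge0. Qed.

Let integrable_pow k (t : R) : nu.-integrable D (fun x => ((t * x) ^+ k / k`!%:R)%:E).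
Proof.
have := integrableZl (measurable_itv `[0%R, +oo[) (t ^+ k / k`!%:R) (integrable_moment k).
apply: eq_integrable => // x _.
by rewrite -EFinM exprMn mulrAC.
Qed.

Let Rintegral_pow k (t : R) : \int[nu]_(x in D) ((t * x) ^+ k / k`!%:R) =
  t ^+ k / k`!%:R * moment k.
Proof.
rewrite -RintegralZl//; last exact: integrable_moment.
by apply: eq_Rintegral => x _; rewrite exprMn mulrAC.
Qed.

Let integrable_rem K (t : R) : 0 <= t ->
  nu.-integrable D (fun x => (expRN_rem K (t * x))%:E).
Proof.
move=> t0; apply: le_integrable (integrable_pow K t) => //.
  apply/measurable_EFinP/measurable_funTS; apply: measurableT_comp.
    exact: measurable_expRN_rem.
  exact: measurable_funM.
move=> x /in_D x0; have tx0 : 0 <= t * x by exact: mulr_ge0.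
rewrite /= lee_fin ger0_norm ?expRN_rem_ge0// (le_trans (expRN_rem_le K tx0))//.
exact: ler_norm.
Qed.

(** Integrate the expansion of e^(-tx): its remainder is, up to sign, in [0, (tx)^K / K!], whence
    the constant [moment K] / K!. *)
Lemma laplace_taylor : taylor_at0 (laplace nu) (fun k => (-1) ^+ k * moment k / k`!%:R).
Proof.
move=> K; exists (moment K / K`!%:R) => t t0.
have -> : laplace nu t - \sum_(k < K) (-1) ^+ k * moment k / k`!%:R * t ^+ k =
    (-1) ^+ K * \int[nu]_(x in D) expRN_rem K (t * x).
  elim: K => [|K IHK]; first by rewrite big_ord0 subr0 expr0 mul1r.
  rewrite big_ord_recr/= opprD addrA IHK RintegralB//; last 2 first.
  - exact: integrable_pow.
  - exact: integrable_rem.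
  by rewrite Rintegral_pow exprS; ring.
rewrite normrM normrX normrN1 expr1n mul1r ger0_norm; last first.
  by apply: Rintegral_ge0 => x /in_D x0; rewrite expRN_rem_ge0// mulr_ge0.
rewrite (_ : _ * _ = \int[nu]_(x in D) ((t * x) ^+ K / K`!%:R)); last first.
  by rewrite Rintegral_pow; ring.
apply: le_Rintegral => //; [exact: integrable_rem|exact: integrable_pow|].
by move=> x /in_D x0; rewrite expRN_rem_le// mulr_ge0.
Qed.

Lemma moment0 : nu `]-oo, 0%R[%classic = 0%E -> moment 0 = 1.
Proof.
move=> nu0; have nuD : nu (~` `]-oo, 0%R[%classic) = 1%E.
  by rewrite probability_setC// nu0 sube0.
rewrite setCitvl in nuD; rewrite /moment; under eq_Rintegral do rewrite expr0.
by rewrite Rintegral_cst// mul1r [X in fine X]nuD.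
Qed.

(** A zero mean would force x = 0 almost everywhere on [0, +oo[, so that both ]-oo, 0] and ]0, +oo[
    would be null. *)
Lemma moment1_gt0 : nu `]-oo, 0%R]%classic = 0%E -> 0 < moment 1.
Proof.
move=> nu0; rewrite lt0r moment_ge0 andbT; apply/negP => /eqP m10.
have i1 := integrable_moment 1; have mid := measurable_int _ i1.
have A0 : (\int[nu]_(x in D) `|(x ^+ 1)%:E| = 0)%E.
  transitivity ((moment 1)%:E); last by rewrite m10.
  rewrite /moment /Rintegral fineK; last exact: integrable_fin_num.
  by apply: eq_integral => x; rewrite inE => /in_D x0; rewrite /= expr1 ger0_norm.
have /ae_eq_integral_abs := A0 => /(_ (measurable_itv _) mid)[N [mN N0 sub]].
have pos0 : nu `]0%R, +oo[%classic = 0%E.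
  apply: (subset_measure0 _ mN) => // x; rewrite /= in_itv/= andbT => x0.
  apply: sub => /=.
  rewrite in_itv/= andbT => /(_ (ltW x0)) [] /eqP; rewrite expr1.
  by rewrite gt_eqF.
have := @probability_setT _ _ _ nu; rewrite -(setUv `]-oo, 0%R]%classic) setCitvl.
rewrite measureU//; last first.
  apply/seteqP; split => x //=; rewrite !in_itv/= andbT => -[].
  by rewrite leNgt => /negbTE ->.
by move=> /eqP; rewrite [X in (X + _)%E]nu0 [X in (_ + X)%E]pos0 adde0 eq_sym onee_eq0.
Qed.

End laplace_taylor.

(** * The exponential law and its transform *)

Section exponential_laplace.
Context (R : realType) (l : R) (l_gt0 : 0 < l).

(* [exponential_prob l] lives on [measurableTypeR R], whose display differs from
   that of the sigma-algebra of a distribution. *)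
Lemma exponential_probability : exists m : probability R R,
  forall A : set R, measurable A ->
    m A = (\int[lebesgue_measure]_(x in A) (exponential_pdf l x)%:E)%E.
Proof.
have mid : measurable_fun setT (idfun : measurableTypeR R -> R).
  exact: measurable_id.
pose X : {mfun measurableTypeR R >-> R} :=
  HB.pack (idfun : measurableTypeR R -> R) (isMeasurableFun.Build _ _ _ _ _ mid).
pose P : probability (measurableTypeR R) R :=
  HB.pack (exponential_prob l) (Probability.on (exponential_prob l)).
by exists (distribution (P l_gt0 l_gt0 l_gt0 l_gt0 l_gt0 l_gt0) X).
Qed.

Variable m : probability R R.
Hypothesis mE : forall A : set R, measurable A ->
  m A = (\int[lebesgue_measure]_(x in A) (exponential_pdf l x)%:E)%E.

Lemma exponential_lt0 : m `]-oo, 0%R[%classic = 0%E.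
Proof.
rewrite mE// integral0_eq// => x; rewrite /= in_itv/= => x0.
by rewrite lt0_exponential_pdf.
Qed.

(** On the half-line, e^(-tx) times the density of rate l is l / (l + t) times the density of rate l
    + t, which integrates to 1. *)
Lemma exponential_laplace t : 0 <= t -> laplace m t = (1 + l^-1 * t)^-1.
Proof.
move=> t0; have lt0 : 0 < l + t by rewrite ltr_pwDl.
have [_ E] := laplace_density (measurable_exponential_pdf l) mE t0.
apply: EFin_inj; rewrite E.
transitivity (\int[lebesgue_measure]_x
  ((l / (l + t))%:E * (exponential_pdf (l + t) x)%:E))%E.
  rewrite integral_mkcond; apply: eq_integral => x _; rewrite patchE.
  have -> : (x \in `[0%R, +oo[%classic) = (0 <= x).
    by apply/idP/idP; rewrite inE/= in_itv/= andbT.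
  case: leP => [x0|x0]; last by rewrite lt0_exponential_pdf// mule0.
  rewrite !exponential_pdfE// -EFinM; congr EFin.
  rewrite (_ : - (l + t) * x = - (t * x) + - l * x); last by ring.
  by rewrite expRD; field; rewrite gt_eqF.
rewrite integralZl//; last exact: integrable_exponential_pdf.
rewrite integral_exponential_pdf// mule1; congr EFin.
by field; rewrite !gt_eqF//.
Qed.

End exponential_laplace.

(** * Uniqueness of the Laplace transform *)

Section laplace_uniqueness.
Context (R : realType).
Local Notation D := (`[0%R, +oo[%classic : set R).

Lemma bernoulli_ineq (a : R) k : 0 <= a -> 1 + a *+ k <= (1 + a) ^+ k.
Proof.
move=> a0; elim: k => [|k IHk]; first by rewrite mulr0n addr0 expr0.
have ak : 0 <= a *+ k by rewrite mulrn_wge0.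
by rewrite exprSr mulrSr; nra.
Qed.

Lemma onem_exp_ge (a : R) k : 0 <= a <= 1 -> 1 - a *+ k <= (1 - a) ^+ k.
Proof.
move=> /andP[a0 a1]; elim: k => [|k IHk]; first by rewrite mulr0n subr0 expr0.
have ak : 0 <= a *+ k by rewrite mulrn_wge0.
by rewrite exprSr mulrSr; nra.
Qed.

(** Combine (1 - a)^k (1 + a)^k <= 1 with (1 + a)^k >= ka, from Bernoulli's inequality. *)
Lemma onem_exp_le (a : R) k : 0 <= a <= 1 -> (0 < k)%N -> 0 < a ->
  (1 - a) ^+ k <= (a *+ k)^-1.
Proof.
move=> /andP[a0 a1] k0 apos.
have ak : 0 < a *+ k by rewrite pmulrn_lgt0.
rewrite -[leRHS]mul1r ler_pdivlMr//.
have P0 : 0 <= (1 - a) ^+ k by rewrite exprn_ge0// subr_ge0.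
apply: (@le_trans _ _ ((1 - a) ^+ k * (1 + a) ^+ k)).
  by rewrite ler_wpM2l// (le_trans _ (bernoulli_ineq k a0))// lerDr.
by rewrite -exprMn exprn_ile1//; nra.
Qed.

(* With v = e^(-(ln 2 / x) y), this is (1 - v^N)^(2^N), which tends to 1 if
   v < 1/2 and to 0 if v > 1/2 by Bernoulli's inequality; v < 1/2 iff x < y. *)
Definition step_approx (x : R) (N : nat) (y : R) : R :=
  (1 - expR (- (ln 2 / x * N%:R * y))) ^+ (2 ^ N).

(** The point y = x is excluded because v = 1/2 there and the limit would be 1/e. *)
Lemma cvg_step_approx (x y : R) : 0 < x -> 0 <= y -> y != x ->
  step_approx x N y @[N --> \oo] --> (\1_`]x, +oo[%classic y : R).
Proof.
move=> x0 y0 yx; pose v := expR (- (ln 2 / x * y)).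
have l2 : 0 < ln 2 / x :> R by rewrite divr_gt0// ln_gt0// ltr1n.
have v0 : 0 < v by exact: expR_gt0.
have v1 : v <= 1 by rewrite expR_le1 oppr_le0 mulr_ge0// ltW.
have vN N : 0 <= v ^+ N <= 1 by rewrite exprn_ge0 ?exprn_ile1// ltW.
have stepE N : step_approx x N y = (1 - v ^+ N) ^+ (2 ^ N).
  by rewrite /step_approx /v -expRM_natr; congr ((1 - expR _) ^+ _); ring.
have halfE : expR (- (ln 2 / x * x)) = 2^-1 :> R.
  by rewrite divfK ?gt_eqF// expRN lnK// posrE.
under eq_cvg do rewrite stepE.
(* Hence the Bernoulli bounds are geometric: 1 - (2v)^N from below when v < 1/2, (2v)^(-N) from
   above when v > 1/2. *)
have pw N : v ^+ N *+ 2 ^ N = (2 * v) ^+ N.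
  by rewrite exprMn -mulr_natl natrX.
rewrite indicE; case: (ltrgtP x y) yx => // [xy|yx] _.
  rewrite mem_set; last by rewrite /= in_itv/= xy.
  have v2 : v < 2^-1 by rewrite -halfE ltr_expR ltrN2 ltr_pM2l.
  apply: (@squeeze_cvgr _ _ _ _ (fun N => 1 - (2 * v) ^+ N) (fun=> 1)).
  - near=> N; rewrite -pw onem_exp_ge//= exprn_ile1// ?subr_ge0.
    + by have /andP[] := vN N.
    + by rewrite gerBl; have /andP[] := vN N.
  - rewrite -[X in _ --> X]subr0; apply: cvgB; first exact: cvg_cst.
    by apply: cvg_expr; rewrite ger0_norm; lra.
  - exact: cvg_cst.
rewrite memNset; last by rewrite /= in_itv/= andbT; apply/negP; rewrite -leNgt ltW.
have v2 : 2^-1 < v by rewrite -halfE ltr_expR ltrN2 ltr_pM2l.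
apply: (@squeeze_cvgr _ _ _ _ (fun=> 0) (fun N => ((2 * v)^-1) ^+ N)).
- near=> N; rewrite exprn_ge0 ?subr_ge0//=; last by have /andP[] := vN N.
  by rewrite exprVn -pw onem_exp_le// ?expn_gt0// exprn_gt0.
- exact: cvg_cst.
- apply: cvg_expr; rewrite ger0_norm ?invr_ge0; last lra.
  by rewrite invf_lt1; lra.
Unshelve. all: by end_near. Qed.

Variables (m1 m2 : probability R R).
Hypothesis laplaceE : forall t : R, 0 <= t -> laplace m1 t = laplace m2 t.

Let integrable_bnd (m : probability R R) (g : R -> R) : measurable_fun setT g ->
  (forall x : R, 0 <= x -> 0 <= g x <= 1) -> m.-integrable D (EFin \o g).
Proof.
move=> mg g01; apply: (@le_integrable _ _ _ m D _ _ (cst 1%E)) => //.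
- by apply/measurable_EFinP; exact: measurable_funTS.
- move=> x; rewrite /= in_itv/= andbT => /g01/andP[g0 g1].
  by rewrite lee_fin !ger0_norm.
- by apply: finite_measure_integrable_cst.
Qed.

(** Induction on k, with v free to absorb the e^(-ux) produced by expanding one factor; k = 0 is the
    equality of the transforms. *)
Lemma Rintegral_onem_exp (u v : R) k : 0 <= u -> 0 <= v ->
  \int[m1]_(x in D) ((1 - expR (- (u * x))) ^+ k * expR (- (v * x))) =
  \int[m2]_(x in D) ((1 - expR (- (u * x))) ^+ k * expR (- (v * x))).
Proof.
move=> u0; have me (t : R) := measurable_expRN t.
have mp w j : measurable_fun setT
    (fun x : R => (1 - expR (- (u * x))) ^+ j * expR (- (w * x))).
  by apply: measurable_funM => //; apply: measurable_funX; apply: measurable_funB.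
have e01 (w x : R) : 0 <= w -> 0 <= x -> 0 <= expR (- (w * x)) <= 1.
  by move=> w0 x0; rewrite expR_ge0 -expR0 ler_expR oppr_le0 mulr_ge0.
have p01 (w : R) j (x : R) : 0 <= w -> 0 <= x ->
    0 <= (1 - expR (- (u * x))) ^+ j * expR (- (w * x)) <= 1.
  move=> w0 x0; have /andP[a0 a1] := e01 u x u0 x0; have /andP[b0 b1] := e01 w x w0 x0.
  have c0 : 0 <= 1 - expR (- (u * x)) by rewrite subr_ge0.
  by rewrite mulr_ge0 ?exprn_ge0//= mulr_ile1 ?exprn_ge0// exprn_ile1// gerBl.
elim: k v => [|k IHk] v v0.
  under eq_Rintegral do rewrite expr0 mul1r.
  under [RHS]eq_Rintegral do rewrite expr0 mul1r.
  exact: laplaceE.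
have step (m : probability R R) :
    \int[m]_(x in D) ((1 - expR (- (u * x))) ^+ k.+1 * expR (- (v * x))) =
    \int[m]_(x in D) ((1 - expR (- (u * x))) ^+ k * expR (- (v * x))) -
    \int[m]_(x in D) ((1 - expR (- (u * x))) ^+ k * expR (- ((u + v) * x))).
  rewrite -RintegralB//; last 2 first.
  - by apply: integrable_bnd => // x; exact: p01.
  - by apply: integrable_bnd => // x; apply: p01; exact: addr_ge0.
  apply: eq_Rintegral => x _.
  by rewrite mulrDl opprD expRD exprSr; ring.
by rewrite !step IHk// IHk// addr_ge0.
Qed.

Lemma measurable_step_approx (x : R) N : measurable_fun setT (step_approx x N).
Proof.
by apply: measurable_funX; apply: measurable_funB => //; exact: measurable_expRN.
Qed.

Lemma step_approx_01 (x y : R) N : 0 < x -> 0 <= y -> 0 <= step_approx x N y <= 1.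
Proof.
move=> x0 y0; have e1 : expR (- (ln 2 / x * N%:R * y)) <= 1.
  rewrite expR_le1 oppr_le0 mulr_ge0// mulr_ge0// ltW// divr_gt0// ln_gt0//.
  exact: ltr1n.
by rewrite exprn_ge0 ?subr_ge0//= exprn_ile1 ?subr_ge0// gerBl expR_ge0.
Qed.

(** Dominated convergence with bound 1; the one exceptional point x is null. *)
Lemma cvg_integral_step_approx (m : probability R R) (x : R) :
  0 < x -> m [set x] = 0%E ->
  ((\int[m]_(y in D) (step_approx x N y)%:E)%E @[N --> \oo] -->
   m `]x, +oo[%classic).
Proof.
move=> x0 mx0.
have -> : m `]x, +oo[%classic = (\int[m]_(y in D) (\1_`]x, +oo[ y)%:E)%E.
  rewrite integral_indic//; congr (m _); apply/esym/setIidl.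
  by move=> y; rewrite /= !in_itv/= !andbT => /(lt_trans x0)/ltW.
have [//|||||_ _ /=] := @dominated_convergence _ _ _ m D (measurable_itv _)
  (fun N y => (step_approx x N y)%:E) (fun y => (\1_`]x, +oo[ y)%:E) (cst 1%E).
- by move=> N; apply/measurable_EFinP/measurable_funTS; exact: measurable_step_approx.
- apply/measurable_EFinP/measurable_funTS; exact: measurable_indic.
- exists [set x]; split => // y /= /not_implyP[Dy ncvg]; apply: contrapT => /eqP yx.
  apply: ncvg; apply/cvg_EFin; first exact: nearW.
  apply: cvg_step_approx => //.
  by move: Dy; rewrite in_itv/= andbT.
- exact: finite_measure_integrable_cst.
- apply: aeW => y N; rewrite /= in_itv/= andbT => y0.
  have /andP[s0 s1] := step_approx_01 N x0 y0.
  by rewrite /= lee_fin ger0_norm.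
exact.
Qed.

Hypothesis m1_le0 : m1 `]-oo, 0%R]%classic = 0%E.
Hypothesis m2_le0 : m2 `]-oo, 0%R]%classic = 0%E.
Hypothesis m1_set1 : forall x, m1 [set x] = 0%E.
Hypothesis m2_set1 : forall x, m2 [set x] = 0%E.

Let eq_ray (x : R) : m1 `]x, +oo[%classic = m2 `]x, +oo[%classic.
Proof.
(* For x <= 0 both rays have mass 1; for x > 0 their masses are limits of equal integrals. *)
have [x0|x0] := ltP 0 x; last first.
  have ray1 (m : probability R R) : m `]-oo, 0%R]%classic = 0%E ->
      m `]x, +oo[%classic = 1%E.
    move=> m0; rewrite -setCitvl probability_setC// (_ : m _ = 0%E) ?sube0//.
    apply: (subset_measure0 _ _ _ m0) => // y; rewrite /= !in_itv/=.
    by move/le_trans; apply.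
  by rewrite !ray1.
have c1 := cvg_integral_step_approx x0 (m1_set1 x).
have c2 := cvg_integral_step_approx x0 (m2_set1 x).
rewrite -(cvg_lim _ c1)// -(cvg_lim _ c2)//; congr (limn _); apply/funext => N.
have u0 : 0 <= ln 2 / x * N%:R.
  by rewrite mulr_ge0// divr_ge0 ?ltW// ln_gt0// ltr1n.
have int_step (m : probability R R) :
    m.-integrable D (EFin \o step_approx x N).
  by apply: integrable_bnd => [|y]; [exact: measurable_step_approx|exact: step_approx_01].
(* A trivial factor with exponent v = 0 brings the integrand to the form of [Rintegral_onem_exp]. *)
have E (m : probability R R) : (\int[m]_(y in D) (step_approx x N y)%:E)%E =
    (\int[m]_(y in D) ((1 - expR (- (ln 2 / x * N%:R * y))) ^+ (2 ^ N) *
                      expR (- (0 * y))))%:E.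
  rewrite -[LHS]fineK; last exact: integrable_fin_num (int_step m).
  by congr EFin; apply: eq_Rintegral => y _; rewrite mul0r oppr0 expR0 mulr1.
by rewrite !E Rintegral_onem_exp.
Qed.

(** The rays ]x, +oo[ are stable under intersection and generate the Borel sets, so [eq_ray]
    suffices. *)
Lemma laplace_unique (A : set R) : measurable A -> m1 A = m2 A.
Proof.
apply: (measure_unique (@RGenOInfty.G R) (fun k => `](- k%:R)%R, +oo[%classic)).
- exact: RGenOInfty.measurableE.
- move=> _ _ [x ->] [y ->]; exists (Num.max x y).
  by apply/seteqP; split => z /=; rewrite !in_itv/= !andbT gt_max => /andP.
- by move=> k; exists (- k%:R).
- apply/seteqP; split => // y _; exists (Num.bound `|y|) => //=.
  rewrite in_itv/= andbT ltrNl (le_lt_trans (ler_norm _))// normrN.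
  exact: archi_boundP.
- by move=> _ [x ->]; exact: eq_ray.
- by move=> k; rewrite (le_lt_trans (probability_le1 _ _))// ltry.
Qed.

End laplace_uniqueness.

(** * Identification of the law *)

Lemma null_itvNyc (R : realType) (m : probability R R) (x : R) :
  m `]-oo, x[%classic = 0%E -> m [set x] = 0%E -> m `]-oo, x]%classic = 0%E.
Proof.
move=> m0 mx; rewrite -(@setUitv1 _ _ -oo%O x true)//.
by apply: null_set_setU.
Qed.

Theorem corollary2 (R : realType) (n : nat) (n_ge2 : (2 <= n)%N)
    (d0 : measure_display) (T0 : measurableType d0) (P0 : probability T0 R)
    (X : {RV P0 >-> R})
    (d : measure_display) (T : measurableType d) (P : probability T R)
    (Xs : 'I_n -> {RV P >-> R})
    (f : R -> R)
    (X_ge0 : {ae P0, forall w, 0 <= X w})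
    (X_density : has_density P0 X f)
    (X_copies : independent_copies Xs X)
    (X_cramer : cramer_condition X)
    (sum_density : has_density P
       (fun w => \sum_(i < n) (i.+1%:R)^-1 * Xs i w)
       (fun x => if 0 <= x then
           \sum_(1 <= j < n.+1)
             'C(n, j)%:R * (-1) ^+ j.-1 * j%:R * f (j%:R * x)
         else 0)) :
  exists2 lambda : R, 0 < lambda & has_density P0 X (exponential_pdf lambda).
Proof.
case: n n_ge2 Xs X_copies sum_density => [|[|n']]// _ Xs' [Xs_indep Xs_law] sum_density'.
have [mf fE] := X_density.
pose nu : probability R R := distribution P0 X.
have nu_set1 x : nu [set x] = 0%E by exact: (density_set1 (m := nu) fE).
have nu_lt0 : nu `]-oo, 0%R[%classic = 0%E.
  have [N [mN N0 sub]] := X_ge0.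
  apply: (subset_measure0 _ mN _ N0).
    by rewrite -[X in measurable X]setTI; exact: measurable_funP.
  by move=> w; rewrite /= in_itv/= => Xw; apply: sub => /=; apply/negP; rewrite -ltNge.
have nu_le0 : nu `]-oo, 0%R]%classic = 0%E.
  exact: null_itvNyc nu_lt0 (nu_set1 0).
have [t0 t0_gt0 cramer] := X_cramer.
have s_gt0 : 0 < t0 / 2 by rewrite divr_gt0.
have exp_moment : (\int[nu]_(x in `[0%R, +oo[) (expR (t0 / 2 * x))%:E < +oo)%E.
  have me : measurable_fun setT (fun x : R => expR (t0 / 2 * x)).
    by apply: measurableT_comp => //; exact: measurable_funM.
  rewrite -(integral_nonneg_support nu_lt0)//.
  rewrite ge0_integral_distribution//; last exact/measurable_EFinP.
  (* Cramer's condition at the negative argument -t0/2 is the exponential moment of rate t0/2. *)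
  have /cramer : - (t0 / 2) \in `]- t0, t0[ by rewrite in_itv/=; apply/andP; split; lra.
  by rewrite opprK unlock.
pose mean := moment nu 1.
have mean_gt0 : 0 < mean by exact: moment1_gt0 s_gt0 exp_moment nu_le0.
have mean_ge0 := ltW mean_gt0.
have Xs_density : has_density P (fun w => \sum_(i < n'.+2) (i.+1%:R)^-1 * Xs' i w)
    (fun x => if 0 <= x then
       \sum_(i < n'.+2) altbin R n'.+2 i * i.+1%:R * f (i.+1%:R * x) else 0).
  move: sum_density'; congr has_density; apply/funext => x; case: ifP => // _.
  by rewrite big_add1 big_mkord.
have laplaceE t : 0 <= t -> laplace nu t = (1 + mean * t)^-1.
  (* The rival solution 1 / (1 + [mean] t) is chosen to share the first-order coefficient
     -[mean]. *)
  apply: (functional_equation_unique (n := n') (laplace_01 nu) _ _ _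
    (laplace_taylor s_gt0 exp_moment) (taylor_at0_inv1D mean_ge0)).
  - move=> u u0; have mu0 : 0 <= mean * u by exact: mulr_ge0.
    by rewrite invr_ge0 invf_le1 ?lerDl ?addr_ge0// ltr_pwDl.
  - exact: (laplace_functional_equation (nu := nu) mf fE nu_lt0
      Xs_indep Xs_law Xs_density).
  - move=> u u0; under eq_bigr do rewrite mulrA.
    under [RHS]eq_bigr do rewrite mulrA.
    by apply: prod_partial_fraction; exact: mulr_ge0.
  - by rewrite expr0 mul1r moment0// fact0 divr1.
  - by rewrite expr0.
  - by rewrite !expr1 mulN1r divr1.
(* The rate of an exponential law is the inverse of its mean. *)
exists mean^-1; first by rewrite invr_gt0.
have rate_gt0 : 0 < mean^-1 by rewrite invr_gt0.
have [m mE] := exponential_probability rate_gt0.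
have mexp := measurable_exponential_pdf mean^-1.
have m_lt0 := exponential_lt0 mE.
have m_set1 x : m [set x] = 0%E by exact: (density_set1 mE).
split=> // A mA; rewrite -mE//.
apply: (@laplace_unique _ nu m) => //.
  by move=> t t_ge0; rewrite (exponential_laplace rate_gt0 mE)// invrK laplaceE.
exact: null_itvNyc m_lt0 (m_set1 0).
Qed.
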